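(* Let $(R_1,\mathcal L_1)$ and $(R_2,\mathcal L_2)$ be recursive rings with a recursive interpretation of a language. Let $d:R_1\to R_2$ be a recursive function and let $\phi:R_1\to R_2$ be a recursive and bijective function. If MRDP holds in $(R_2,\mathcal L_2)$, then $d$ is given by a Diophantine expression in $\phi$.
   Context: A recursive ring is a ring $R$ with a fixed recursive representation, i.e. an injection $j:R\to\mathbb N$ with recursive image for which addition and multiplication are recursive; subsets of $R^k$ are recursive / recursively enumerable if their images under $j^k$ are, and a function $R_1\to R_2$ is recursive if its translation $j_2\circ f\circ j_1^{-1}$ is the restriction of a recursive function. A language $\mathcal L$ (constants, functions, relations; always containing a constant $0$ and equality) has a recursive interpretation in $R$ if all its functions are interpreted by recursive functions and all its relations by recursive sets. Terms are built from constants and variables using functions of $\mathcal L$; basic formulas are $(t_1,\ldots,t_k)\in R'$ with $R'\in\mathcal L$ a $k$-ary relation (possibly equality). $S\subset R^k$ is Diophantine if $S=\{\vec x\in R^k\mid\exists\vec y\in R^l\ (f_1\wedge\cdots\wedge f_r)\}$ for some basic formulas $f_i$. MRDP holds in $(R,\mathcal L)$ if every recursively enumerable $S\subset R$ is Diophantine. A map $d:R_1\to R_2$ is given by a Diophantine expression in $\phi:R_1\to R_2$ if there are basic $\mathcal L_2$-formulas $f_1,\ldots,f_n$ and an $l$ such that for all $x\in R_1$, $z\in R_2$: $d(x)=z\iff\exists\vec y\in R_2^{l},\ \forall1\le i\le n,\ f_i(\phi(x),\vec y,z)$.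
   Formalization: MRDP is assumed for recursively enumerable subsets of every power R_2^k, not only of R_2 itself; with subsets of R_2 alone the claim is false for some languages (e.g. on the integers with d(x)=x+1, φ the identity and a language with only a parity-preserving projection and unary relations). *)

(* Defs.v *)
From HB Require Import structures.
From mathcomp Require Import all_boot all_algebra.
From mathcomp Require Import boolp classical_sets.

Set Implicit Arguments.
Unset Strict Implicit.
Unset Printing Implicit Defensive.

Import GRing.Theory.

Local Open Scope classical_set_scope.
Local Open Scope ring_scope.

(* Kleene's mu-recursive functions: [partrec k] is the type of programs for
   partial recursive functions from nat^k to nat. *)
Inductive partrec : nat -> Type :=
| PZero : partrec 0
| PSucc : partrec 1
| PProj k (i : 'I_k) : partrec k
| PComp k m (f : partrec m) (g : 'I_m -> partrec k) : partrec k
| PRec k (f : partrec k) (g : partrec k.+2) : partrec k.+1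
| PMin k (f : partrec k.+1) : partrec k.

(* [computes c x y]: the program c halts on input x with output y.
   The recursion argument is the first one:
     PRec f g (0, x) = f x,  PRec f g (n+1, x) = g (n, PRec f g (n, x), x),
   and PMin f x is the least y with f (y, x) = 0, all the values f (i, x)
   with i < y being defined. *)
Fixpoint computes k (c : partrec k) : k.-tuple nat -> nat -> Prop :=
  match c in partrec k return k.-tuple nat -> nat -> Prop with
  | PZero => fun _ y => y = 0%N
  | PSucc => fun x y => y = (thead x).+1
  | PProj k i => fun x y => y = tnth x i
  | PComp k m f g => fun x y => exists z : m.-tuple nat,
      (forall i, computes (g i) x (tnth z i)) /\ computes f z y
  | PRec k f g => fun x y =>
      let x' : k.-tuple nat := behead_tuple x in
      (fix iterate (n : nat) (y : nat) {struct n} : Prop :=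
         match n with
         | 0 => computes f x' y
         | n'.+1 => exists v, iterate n' v /\
                      computes g (cons_tuple n' (cons_tuple v x')) y
         end) (thead x) y
  | PMin k f => fun x y =>
      computes f (cons_tuple y x) 0%N /\
      (forall i, (i < y)%N -> exists v, computes f (cons_tuple i x) v.+1)
  end.

Definition rec_natfun k (F : k.-tuple nat -> nat) : Prop :=
  exists c : partrec k, forall x y, computes c x y <-> F x = y.

Definition rec_natset k (A : set (k.-tuple nat)) : Prop :=
  exists2 chi : k.-tuple nat -> bool,
    rec_natfun (fun x => nat_of_bool (chi x)) & forall x, A x <-> chi x.

(* Domains of partial recursive functions. *)
Definition re_natset k (A : set (k.-tuple nat)) : Prop :=
  exists c : partrec k, forall x, A x <-> exists y, computes c x y.

Definition rec_set (T : Type) (j : T -> nat) k (S : set (k.-tuple T)) : Prop :=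
  rec_natset ((fun x => map_tuple j x) @` S).

Definition re_set (T : Type) (j : T -> nat) k (S : set (k.-tuple T)) : Prop :=
  re_natset ((fun x => map_tuple j x) @` S).

Definition rec_fun (T1 T2 : Type) (j1 : T1 -> nat) (j2 : T2 -> nat) k
    (f : k.-tuple T1 -> T2) : Prop :=
  exists2 F : k.-tuple nat -> nat,
    rec_natfun F & forall x, F (map_tuple j1 x) = j2 (f x).

Definition rec_map (T1 T2 : Type) (j1 : T1 -> nat) (j2 : T2 -> nat)
    (f : T1 -> T2) : Prop :=
  rec_fun j1 j2 (fun x : 1.-tuple T1 => f (thead x)).

(* Since the domain is all of R, the second clause says that the image of j
   is recursive. *)
Definition rec_representation (R : pzRingType) (j : R -> nat) : Prop :=
  [/\ injective j,
      rec_set j [set: 1.-tuple R],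
      rec_fun j j (fun x : 2.-tuple R => tnth x ord0 + tnth x ord_max)
    & rec_fun j j (fun x : 2.-tuple R => tnth x ord0 * tnth x ord_max)].

(* Equality is not listed among the relation symbols: it is the constructor
   [BEq] of basic formulas, always interpreted by Leibniz equality. *)
Record language := Language {
  cst_symb : Type;
  fun_symb : Type;
  rel_symb : Type;
  fun_arity : fun_symb -> nat;
  rel_arity : rel_symb -> nat;
  zero_symb : cst_symb }.

Record interpretation (L : language) (T : Type) := Interpretation {
  cst_interp : cst_symb L -> T;
  fun_interp : forall f : fun_symb L, (fun_arity f).-tuple T -> T;
  rel_interp : forall r : rel_symb L, set ((rel_arity r).-tuple T) }.

Definition rec_interpretation (L : language) (R : pzRingType) (j : R -> nat)
    (I : interpretation L R) : Prop :=
  [/\ cst_interp I (zero_symb L) = 0,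
      forall f, rec_fun j j (@fun_interp L R I f)
    & forall r, rec_set j (@rel_interp L R I r)].

(* Terms and basic formulas in n variables. *)
Inductive term (L : language) (n : nat) : Type :=
| TVar of 'I_n
| TCst of cst_symb L
| TFun (f : fun_symb L) of 'I_(fun_arity f) -> term L n.

Inductive basic_formula (L : language) (n : nat) : Type :=
| BRel (r : rel_symb L) of 'I_(rel_arity r) -> term L n
| BEq of term L n & term L n.

Fixpoint term_val (L : language) (T : Type) (I : interpretation L T) n
    (e : n.-tuple T) (t : term L n) : T :=
  match t with
  | TVar i => tnth e i
  | TCst c => cst_interp I c
  | TFun f a => fun_interp I [tuple term_val I e (a i) | i < fun_arity f]
  end.

Definition holds (L : language) (T : Type) (I : interpretation L T) n
    (e : n.-tuple T) (b : basic_formula L n) : Prop :=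
  match b with
  | BRel r a => rel_interp I [tuple term_val I e (a i) | i < rel_arity r]
  | BEq t u => term_val I e t = term_val I e u
  end.

Definition diophantine (L : language) (T : Type) (I : interpretation L T) k
    (S : set (k.-tuple T)) : Prop :=
  exists (l r : nat) (f : 'I_r -> basic_formula L (k + l)),
    forall x : k.-tuple T,
      S x <-> exists y : l.-tuple T, forall i, holds I (cat_tuple x y) (f i).

(* All the powers R^k are covered, not only R itself: over an arbitrary
   language, the case k = 1 does not imply the case k = 2. *)
Definition MRDP (L : language) (R : pzRingType) (j : R -> nat)
    (I : interpretation L R) : Prop :=
  forall k (S : set (k.-tuple R)), re_set j S -> diophantine I S.

(* The variables of the formulas are, in this order, phi x, y, z. *)
Definition diophantine_expression (L2 : language) (T1 T2 : Type)
    (I2 : interpretation L2 T2) (phi d : T1 -> T2) : Prop :=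
  exists (n l : nat) (f : 'I_n -> basic_formula L2 l.+2),
    forall (x : T1) (z : T2),
      d x = z <->
      exists y : l.-tuple T2, forall i,
        holds I2 (cons_tuple (phi x) (rcons_tuple y z)) (f i).

(* Main.v *)
Require Import Defs.
From mathcomp Require Import all_boot all_algebra.
From mathcomp Require Import boolp classical_sets.

(** The map [d] factors through the injection [phi], so that [d x = z] holds
    exactly when [(phi x, z)] lies in
    [S = {(phi x, d x) | x in R1}], a subset of [R2 ^ 2].  Read through [j2],
    the set [S] consists of the pairs [(a, b)] such that some natural number
    [n] in the image of [j1] satisfies [Phi n = a] and [D n = b], where [Phi]
    and [D] are recursive functions that extend the translations of [phi] and
    [d].  The matrix of this existential statement is decidable, hence [S] is
    the domain of an unbounded search and is recursively enumerable
    ([re_natset_exists], [re_set_range_pair]).  MRDP makes [S] Diophantine, and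
    it remains to permute the variables of the formulas ([holds_rename]),
    because a Diophantine definition lists them as [phi x], [z], [y] and a
    Diophantine expression as [phi x], [y], [z]. *)

Set Implicit Arguments.
Unset Strict Implicit.
Unset Printing Implicit Defensive.

Local Open Scope classical_set_scope.

Lemma eq_rec_natfun k (F G : k.-tuple nat -> nat) :
  F =1 G -> rec_natfun F -> rec_natfun G.
Proof. by move=> FG [c hc]; exists c => x y; rewrite hc FG. Qed.

Lemma rec_natfun_proj k (i : 'I_k) : rec_natfun (fun x => tnth x i).
Proof. by exists (PProj i) => x y /=; split=> ->. Qed.

Lemma rec_natfun_comp m k (F : m.-tuple nat -> nat)
    (G : 'I_m -> k.-tuple nat -> nat) :
  rec_natfun F -> (forall i, rec_natfun (G i)) ->
  rec_natfun (fun x => F [tuple G i x | i < m]).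
Proof.
move=> [f hf] /choice[g hg]; exists (PComp f g) => x y /=; split.
  case=> z [hz /hf <-]; congr F; apply: eq_from_tnth => i.
  by rewrite tnth_mktuple; apply/hg.
move=> <-; exists [tuple G i x | i < m]; split; last exact/hf.
by move=> i; apply/hg; rewrite tnth_mktuple.
Qed.

Lemma rec_natfun_comp1 k (F : 1.-tuple nat -> nat) (G : k.-tuple nat -> nat) :
  rec_natfun F -> rec_natfun G -> rec_natfun (fun x => F [tuple G x]).
Proof.
move=> hF hG; apply: eq_rec_natfun (rec_natfun_comp hF (fun=> hG)) => x.
by congr F; apply: eq_from_tnth => i; rewrite tnth_mktuple ord1.
Qed.

Lemma rec_natfun_comp2 k (op : nat -> nat -> nat) (G H : k.-tuple nat -> nat) :
  rec_natfun (fun x : 2.-tuple nat => op (tnth x ord0) (tnth x ord_max)) ->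
  rec_natfun G -> rec_natfun H -> rec_natfun (fun x => op (G x) (H x)).
Proof.
move=> hop hG hH.
have hGH (i : 'I_2) : rec_natfun (if i == ord0 then G else H) by case: ifP.
by apply: eq_rec_natfun (rec_natfun_comp hop hGH) => x; rewrite !tnth_mktuple.
Qed.

Lemma rec_natfun_prec k (F : k.-tuple nat -> nat) (G : k.+2.-tuple nat -> nat)
    (H : k.+1.-tuple nat -> nat) :
  rec_natfun F -> rec_natfun G ->
  (forall x : k.-tuple nat, H (cons_tuple 0 x) = F x) ->
  (forall n (x : k.-tuple nat), H (cons_tuple n.+1 x) =
     G (cons_tuple n (cons_tuple (H (cons_tuple n x)) x))) ->
  rec_natfun H.
Proof.
move=> [f hf] [g hg] H0 HS; exists (PRec f g) => x y.
have -> : H x = H (cons_tuple (thead x) (behead_tuple x)).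
  by congr H; rewrite [LHS]tuple_eta; exact: val_inj.
move=> /=; move: (behead_tuple x : k.-tuple nat) => x'.
elim: (thead x) y => [|n IHn] y /=; first by rewrite hf H0.
rewrite HS; split; first by move=> [v [/IHn <- /hg]].
by move=> /hg hy; exists (H (cons_tuple n x')); split=> //; apply/IHn.
Qed.

Lemma rec_natfun_succ k (G : k.-tuple nat -> nat) :
  rec_natfun G -> rec_natfun (fun x => (G x).+1).
Proof.
move=> hG; apply: (@rec_natfun_comp1 k (fun x => (thead x).+1)) hG.
by exists PSucc => x y /=; split=> ->.
Qed.

Lemma rec_natfun_pred k (G : k.-tuple nat -> nat) :
  rec_natfun G -> rec_natfun (fun x => (G x).-1).
Proof.
move=> hG; apply: (@rec_natfun_comp1 k (fun x => (thead x).-1)) hG.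
have h0 : rec_natfun (fun _ : 0.-tuple nat => 0).
  by exists PZero => x y /=; split=> ->.
by apply: (rec_natfun_prec h0 (rec_natfun_proj ord0)) => *; rewrite ?(tnth_nth 0).
Qed.

Lemma rec_natfun_addn k (G H : k.-tuple nat -> nat) :
  rec_natfun G -> rec_natfun H -> rec_natfun (fun x => G x + H x).
Proof.
apply: rec_natfun_comp2.
apply: (rec_natfun_prec (rec_natfun_proj ord0)
  (rec_natfun_succ (rec_natfun_proj (lift ord0 ord0)))) => *;
  by rewrite !(tnth_nth 0).
Qed.

Lemma rec_natfun_subn k (G H : k.-tuple nat -> nat) :
  rec_natfun G -> rec_natfun H -> rec_natfun (fun x => G x - H x).
Proof.
move=> hG hH; apply: (@rec_natfun_comp2 k (fun b a => a - b)) hH hG.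
(* Recursion takes place on the first argument, here the subtrahend. *)
apply: (rec_natfun_prec (rec_natfun_proj ord0)
  (rec_natfun_pred (rec_natfun_proj (lift ord0 ord0)))) => *;
  by rewrite !(tnth_nth 0) /= ?subn0 ?subnS.
Qed.

(** The symmetric difference [(a - b) + (b - a)] of natural numbers, which
    vanishes only for [a = b], is a recursive test for equality. *)
Lemma rec_natfun_dist k (G H : k.-tuple nat -> nat) :
  rec_natfun G -> rec_natfun H ->
  rec_natfun (fun x => (G x - H x) + (H x - G x)).
Proof. by move=> hG hH; apply: rec_natfun_addn; apply: rec_natfun_subn. Qed.

(** The projection of the zero set of a total recursive function is the domain
    of an unbounded search. *)
Lemma re_natset_exists k (F : k.+1.-tuple nat -> nat) :
  rec_natfun F ->
  re_natset [set x : k.-tuple nat | exists n, F (cons_tuple n x) = 0].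
Proof.
move=> [c hc]; exists (PMin c) => x /=; split; last first.
  by move=> [n [/hc Fn0 _]]; exists n.
move=> [n Fn0].
have exF : exists n, F (cons_tuple n x) == 0 by exists n; apply/eqP.
case: (ex_minnP exF) => m /eqP Fm0 minm; exists m; split; first exact/hc.
move=> i ltim; exists (F (cons_tuple i x)).-1; apply/hc.
rewrite prednK // lt0n; apply/negP => /minm.
by rewrite leqNgt ltim.
Qed.

Lemma re_set_range_pair (T1 T2 : Type) (j1 : T1 -> nat) (j2 : T2 -> nat)
    (f g : T1 -> T2) :
  rec_set j1 [set: 1.-tuple T1] -> rec_map j1 j2 f -> rec_map j1 j2 g ->
  re_set j2 (range (fun x => [tuple f x; g x])).
Proof.
move=> [chi hchi chiP] [F hF FE] [G hG GE].
(* The search variable n comes first, before the pair (a, b); the three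
   summands test that n encodes some x, that F n = a and that G n = b. *)
pose V k i : k.+1.-tuple nat -> nat := fun x => tnth x (inord i).
pose N (x : 3.-tuple nat) : 1.-tuple nat := [tuple V 2 0 x].
pose D m n := (m - n) + (n - m).
pose E x := D 1 (chi (N x)) + (D (F (N x)) (V 2 1 x) + D (G (N x)) (V 2 2 x)).
have hV i : rec_natfun (V 2 i) by exact: rec_natfun_proj.
have hN (H : 1.-tuple nat -> nat) : rec_natfun H -> rec_natfun (H \o N).
  by move=> hH; exact: (rec_natfun_comp1 hH (hV 0)).
have h1 : rec_natfun (fun _ : 3.-tuple nat => 1).
  apply: eq_rec_natfun (rec_natfun_succ (rec_natfun_subn (hV 0) (hV 0))) => x.
  by rewrite subnn.
have hE : rec_natfun E.
  apply: rec_natfun_addn; first exact: rec_natfun_dist h1 (hN _ hchi).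
  apply: rec_natfun_addn; first exact: rec_natfun_dist (hN _ hF) (hV 1).
  exact: rec_natfun_dist (hN _ hG) (hV 2).
have D0 m n : (D m n == 0) = (m == n).
  by rewrite addn_eq0 !subn_eq0 -eqn_leq.
have E0 n (x : 2.-tuple nat) : E (cons_tuple n x) = 0 <->
    [/\ chi [tuple n], F [tuple n] = tnth x ord0 & G [tuple n] = tnth x ord_max].
  have -> : E (cons_tuple n x) = D 1 (chi [tuple n]) +
      (D (F [tuple n]) (tnth x ord0) + D (G [tuple n]) (tnth x ord_max)).
    have Nn : N (cons_tuple n x) = [tuple n].
      by apply: val_inj; rewrite /= /V (tnth_nth 0) inordK.
    by rewrite /E Nn /V !(tnth_nth 0) !inordK.
  split.
    move=> /eqP; rewrite addn_eq0 D0 addn_eq0 !D0.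
    by move=> /and3P[h /eqP ? /eqP ?]; split=> //; case: (chi _) h.
  by case=> -> -> ->; rewrite /D !subnn.
have [c hc] := re_natset_exists hE; exists c => x.
rewrite -{}hc; split.
  move=> [_ [u _ <-] <-]; exists (j1 u).
  have ju : [tuple j1 u] = map_tuple j1 [tuple u] by exact: val_inj.
  apply/E0; split.
  - by rewrite ju; apply/chiP; exists [tuple u].
  - by rewrite ju FE !(tnth_nth 0).
  - by rewrite ju GE !(tnth_nth 0).
move=> [n /E0[/chiP[u _ un] Fn Gn]].
exists [tuple f (thead u); g (thead u)]; first by exists (thead u).
apply: eq_from_tnth => i; move: Fn Gn; rewrite -un FE GE !(tnth_nth 0).
by case: i => [[|[|i]]].
Qed.

(** Substitution of the variable [s i] for the variable [i] in a term. *)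
Fixpoint term_rename L n m (s : 'I_n -> 'I_m) (t : term L n) : term L m :=
  match t with
  | TVar i => TVar L (s i)
  | TCst c => TCst m c
  | TFun f a => TFun (fun i => term_rename s (a i))
  end.

(** Substitution of the variable [s i] for the variable [i] in a basic
    formula. *)
Definition formula_rename L n m (s : 'I_n -> 'I_m) (b : basic_formula L n) :
    basic_formula L m :=
  match b with
  | BRel r a => BRel (fun i => term_rename s (a i))
  | BEq t u => BEq (term_rename s t) (term_rename s u)
  end.

Lemma term_val_rename L T (I : interpretation L T) n m (s : 'I_n -> 'I_m)
    (e : m.-tuple T) (t : term L n) :
  term_val I e (term_rename s t) = term_val I [tuple tnth e (s i) | i < n] t.
Proof.
elim: t => [i|c|f a IHa] //=; first by rewrite tnth_mktuple.
by congr fun_interp; apply: eq_mktuple.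
Qed.

Lemma holds_rename L T (I : interpretation L T) n m (s : 'I_n -> 'I_m)
    (e : m.-tuple T) (b : basic_formula L n) :
  holds I e (formula_rename s b) = holds I [tuple tnth e (s i) | i < n] b.
Proof.
case: b => [r a|t u] /=; last by rewrite !term_val_rename.
by congr (rel_interp _); apply: eq_mktuple => i; exact: term_val_rename.
Qed.

(** The renaming that carries the order of variables [a, z, y] to
    [a, y, z]. *)
Definition second_to_last l (i : 'I_(2 + l)) : 'I_l.+2 :=
  if i == 0 :> nat then ord0 else if i == 1 :> nat then ord_max else inord i.-1.

Lemma tnth_second_to_last T l (a z : T) (y : l.-tuple T) :
  [tuple tnth (cons_tuple a (rcons_tuple y z)) (second_to_last i) | i < 2 + l]
  = cat_tuple [tuple a; z] y.
Proof.
apply: eq_from_tnth => -[i lti]; rewrite tnth_mktuple !(tnth_nth a).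
rewrite /second_to_last /=; case: i lti => [|[|i]] //= lti.
  by rewrite nth_rcons size_tuple ltnn eqxx.
by rewrite inordK ?(ltnW lti) //= nth_rcons size_tuple (lti : i < l).
Qed.

Theorem lemma6p28 (R1 R2 : pzRingType) (j1 : R1 -> nat) (j2 : R2 -> nat)
    (L1 L2 : language) (I1 : interpretation L1 R1) (I2 : interpretation L2 R2)
    (d phi : R1 -> R2)
    (hj1 : rec_representation j1) (hj2 : rec_representation j2)
    (hI1 : rec_interpretation j1 I1) (hI2 : rec_interpretation j2 I2)
    (hd : rec_map j1 j2 d)
    (hphi : rec_map j1 j2 phi) (phi_bij : bijective phi)
    (hMRDP : MRDP j2 I2) :
  diophantine_expression I2 phi d.
Proof.
have [_ hj1_range _ _] := hj1.
have [l [r [f hf]]] := hMRDP _ _ (re_set_range_pair hj1_range hphi hd).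
exists r, l, (fun i => formula_rename (@second_to_last l) (f i)) => x z.
have graphE : d x = z <->
    range (fun x => [tuple phi x; d x]) [tuple phi x; z].
  split=> [<-|[x' _ /(congr1 val)[/(bij_inj phi_bij) <- //]]].
  by exists x.
rewrite graphE hf.
by split=> -[y hy]; exists y => i; move: (hy i);
  rewrite holds_rename tnth_second_to_last.
Qed.
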